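(* Let $M$ be a smooth manifold with a metric tensor $\boldsymbol\eta$ (non-degenerate, of arbitrary signature) and an $\boldsymbol\eta$-compatible connection with covariant derivative ${}_{\boldsymbol\eta}\mathcal D$. Let $\mathtt h:M\to M$ be a diffeomorphism, let $\boldsymbol g=\mathtt h^{*}\boldsymbol\eta$, and let ${}_{\boldsymbol g}\mathcal D=\mathtt h^{*}\,{}_{\boldsymbol\eta}\mathcal D$ be the deformed (pulled back) connection, i.e. the connection determined by $$\mathtt h_*^{-1}\big({}_{\boldsymbol\eta}\mathcal D_v u\big)={}_{\boldsymbol g}\mathcal D_{\mathtt h_*^{-1}v}\,\mathtt h_*^{-1}u$$ for all smooth vector fields $u,v$ on $M$. If ${}_{\boldsymbol\eta}\mathcal D$ has zero curvature tensor and zero torsion tensor, then ${}_{\boldsymbol g}\mathcal D$ also has zero curvature tensor and zero torsion tensor.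
   Context: $\mathtt h_*^{-1}$ denotes the pushforward of vector fields by $\mathtt h^{-1}$ (equivalently the pullback of vector fields by $\mathtt h$). For a connection $\mathcal D$, the torsion is $T(a,b)=\mathcal D_ab-\mathcal D_ba-[a,b]$ and the curvature is $\rho(a,b,c)=\mathcal D_a\mathcal D_bc-\mathcal D_b\mathcal D_ac-\mathcal D_{[a,b]}c$. A connection is compatible with a metric tensor if the covariant derivative of the metric tensor vanishes. *)

(* Defs.v *)
From HB Require Import structures.
From mathcomp Require Import all_boot all_order all_algebra.
From mathcomp Require Import boolp classical_sets functions reals.
From mathcomp Require Import ring.
From mathcomp Require Import topology normedtype landau derive.

Set Implicit Arguments.
Unset Strict Implicit.
Unset Printing Implicit Defensive.

Import Order.TTheory GRing.Theory Num.Theory.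
Import numFieldNormedType.Exports.

Local Open Scope classical_set_scope.
Local Open Scope ring_scope.

Section SmoothOn.
Context {R : realType}.

(* Intended for open U and finite-dimensional V: f and its iterated directional
   derivatives of order < k are Frechet differentiable on U, and those of order
   k are continuous on U, i.e. f is of class C^k on U. *)
Fixpoint Ck_on (V W : normedModType R) (k : nat) (U : set V) (f : V -> W) :
    Prop :=
  match k with
  | 0 => forall x, U x -> {for x, continuous f}
  | k'.+1 => (forall x, U x -> differentiable f x) /\
             (forall v, Ck_on k' U ('D_v f))
  end.

Definition smooth_on (V W : normedModType R) (U : set V) (f : V -> W) : Prop :=
  forall k, Ck_on k U f.

Section Theory.
Variables (V W : normedModType R).
Implicit Types (U : set V) (f g : V -> W).

Lemma near_eq_differentiable f g (x : V) :
  {near x, f =1 g} -> differentiable f x -> differentiable g x.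
Proof.
move=> fg df; have fgx : f x = g x := nbhs_singleton fg.
suff d0 : differentiable (g - f) x.
  by rewrite -(subrK f g); exact: differentiableD.
apply/diff_locallyP.
have gfx : (g - f) x = 0 by rewrite !fctE fgx subrr.
have H : (g - f) \o shift x = cst ((g - f) x) + (\0 : V -> W) +o_ 0 id.
  rewrite gfx; apply: eqaddoE.
  rewrite (_ : cst 0 + _ = 0); last by apply/funext => y; rewrite !fctE addr0.
  rewrite add0r; apply/eqoP => e e0.
  have : \forall y \near x, f y = g y by [].
  rewrite (near_shift 0) subr0 => K.
  near=> y.
  have /= E : (f \o shift x) y = (g \o shift x) y by near: y.
  by rewrite !fctE /= E subrr normr0 mulr_ge0// ltW.
have c0 : continuous (\0 : V -> W) by move=> ?; exact: cst_continuous.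
have -> : 'd (g - f) x = \0 :> (V -> W) by exact: diff_unique.
by [].
Unshelve. all: by end_near. Qed.

Lemma Ck_on_sub k U U' f : U `<=` U' -> Ck_on k U' f -> Ck_on k U f.
Proof.
move=> UU'; elim: k f => [|k IH] f /=; first by move=> cf x /UU'/cf.
by case=> df Df; split=> [x /UU'/df//|v]; exact/IH.
Qed.

Lemma Ck_on_local k U f :
  (forall x, U x -> exists2 U', U' x & Ck_on k U' f) -> Ck_on k U f.
Proof.
elim: k f => [|k IH] f /= H.
  by move=> x /H[U' U'x cf]; exact: cf.
split=> [x /H[U' U'x [df _]]|v]; first exact: df.
by apply: IH => x /H[U' U'x [_ Df]]; exists U'.
Qed.

Lemma Ck_on_eq k U f g : open U -> (forall x, U x -> f x = g x) ->
  Ck_on k U f -> Ck_on k U g.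
Proof.
move=> oU; elim: k f g => [|k IH] f g fg /=.
  move=> cf x Ux.
  have nfg : {near x, g =1 f}.
    by apply: filterS (open_nbhs_nbhs (conj oU Ux)) => y /fg.
  have nfg' : {near x, f =1 g} by apply: filterS nfg => y /= ->.
  rewrite /prop_for /continuous_at -(fg _ Ux).
  exact: cvg_trans (near_eq_cvg nfg') (cf _ Ux).
have nfg x : U x -> {near x, f =1 g}.
  by move=> Ux; apply: filterS (open_nbhs_nbhs (conj oU Ux)) => y /fg.
move=> [df Df]; split=> [x Ux|v].
  by apply: near_eq_differentiable (df _ Ux); exact: nfg.
by apply: IH (Df v) => x Ux; apply: near_eq_derive; exact: nfg.
Qed.

Lemma Ck_onW k U f : Ck_on k.+1 U f -> Ck_on k U f.
Proof.
elim: k f => [|k IH] f.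
  by case=> df _ x /df; exact: differentiable_continuous.
by case=> df Df; split=> // v; exact/IH/Df.
Qed.

Lemma Ck_on_cst k U (a : W) : Ck_on k U (cst a : V -> W).
Proof.
elim: k a => [|k IH] a /=; first by move=> x _; exact: cst_continuous.
split=> // v; rewrite (_ : 'D_v _ = cst 0) //.
by apply/funext => x; rewrite derive_cst.
Qed.

Lemma Ck_onD k U f g : open U -> Ck_on k U f -> Ck_on k U g ->
  Ck_on k U (f + g).
Proof.
move=> oU; elim: k f g => [|k IH] f g /=.
  by move=> cf cg x Ux; apply: continuousD; [exact: cf|exact: cg].
move=> [df Df] [dg Dg]; split=> [x Ux|v].
  by apply: differentiableD; [exact: df|exact: dg].
apply: (Ck_on_eq oU _ (IH _ _ (Df v) (Dg v))) => x Ux.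
by rewrite deriveD//; apply: diff_derivable; [exact: df|exact: dg].
Qed.

Lemma Ck_onZ k U (a : R) f : open U -> Ck_on k U f -> Ck_on k U (a *: f).
Proof.
move=> oU; elim: k f => [|k IH] f /=.
  by move=> cf x Ux; apply: continuousZr; exact: cf.
move=> [df Df]; split=> [x Ux|v].
  by apply: differentiableZ; exact: df.
apply: (Ck_on_eq oU _ (IH _ (Df v))) => x Ux.
by rewrite deriveZ//; apply: diff_derivable; exact: df.
Qed.

Lemma Ck_on_sum k U n (f : 'I_n -> V -> W) : open U ->
  (forall i, Ck_on k U (f i)) -> Ck_on k U (\sum_i f i).
Proof.
move=> oU cf; elim/big_ind: _ => // [|? ? ? ?]; last exact: Ck_onD.
exact: (Ck_on_cst k U 0).
Qed.

End Theory.

Lemma Ck_onM (V : normedModType R) k (U : set V) (f g : V -> R) : open U ->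
  Ck_on k U f -> Ck_on k U g -> Ck_on k U (f * g).
Proof.
move=> oU; elim: k f g => [|k IH] f g.
  by move=> cf cg x Ux; apply: continuousM; [exact: cf|exact: cg].
move=> kf kg; have [df Df] := kf; have [dg Dg] := kg; split=> [x Ux|v].
  by apply: differentiableM; [exact: df|exact: dg].
have Df' := IH _ _ (Ck_onW kf) (Dg v); have Dg' := IH _ _ (Ck_onW kg) (Df v).
apply: (Ck_on_eq oU _ (Ck_onD oU Df' Dg')) => x Ux.
by rewrite deriveM//; apply: diff_derivable; [exact: df|exact: dg].
Qed.

Lemma Ck_on_coord (V : normedModType R) m k (U : set V) (f : V -> 'rV[R]_m) i :
  open U -> Ck_on k U f -> Ck_on k U (fun x => f x 0 i).
Proof.
move=> oU; elim: k f => [|k IH] f /=.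
  move=> cf x Ux.
  exact: (continuous_comp (cf x Ux) (@coord_continuous _ _ _ 0 i (f x))).
have dc x := @differentiable_coord R _ _ (f x) 0 i.
move=> [df Df]; split=> [x Ux|v].
  exact: (differentiable_comp (df x Ux) (dc x)).
apply: (Ck_on_eq oU _ (IH _ (Df v))) => x Ux.
have c_lin : linear (fun N : 'rV[R]_m => N 0 i : R).
  by move=> a M N; rewrite !mxE.
pose cM := GRing.isLinear.Build _ _ _ _ _ c_lin.
pose c : {linear 'rV[R]_m -> R} := HB.pack (fun N : 'rV[R]_m => N 0 i : R) cM.
rewrite deriveE; last exact: df.
rewrite deriveE; last exact: (differentiable_comp (df x Ux) (dc x)).
rewrite (diff_comp (df x Ux) (dc x)) /=.
have -> : 'd (fun N : 'rV[R]_m => N 0 i) (f x) = c :> (_ -> _).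
  exact: (diff_lin (f x) (@coord_continuous _ _ _ 0 i : continuous c)).
by [].
Qed.

Lemma Ck_on_comp (V : normedModType R) m k (U : set V) (U' : set 'rV[R]_m)
    (g : V -> 'rV[R]_m) (f : 'rV[R]_m -> R) :
  open U -> (forall x, U x -> U' (g x)) ->
  Ck_on k U g -> Ck_on k U' f -> Ck_on k U (f \o g).
Proof.
move=> oU UU'; elim: k f => [|k IH] f.
  by move=> cg cf x Ux; apply: continuous_comp (cg x Ux) (cf _ (UU' _ Ux)).
move=> kg [df Df]; have [dg Dg] := kg; split=> [x Ux|v].
  exact: (differentiable_comp (dg x Ux) (df _ (UU' _ Ux))).
pose e i : 'rV[R]_m := delta_mx 0 i.
have S : Ck_on k U (\sum_i (fun x => 'D_v g x 0 i : R) * ('D_(e i) f \o g)).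
  apply: Ck_on_sum => // i; apply: Ck_onM => //; first exact: Ck_on_coord oU (Dg v).
  exact: IH (Ck_onW kg) (Df _).
apply: (Ck_on_eq oU _ S) => x Ux.
rewrite deriveE; last exact: (differentiable_comp (dg x Ux) (df _ (UU' _ Ux))).
rewrite (diff_comp (dg x Ux) (df _ (UU' _ Ux))) /=.
rewrite -(deriveE v (dg x Ux)) [in RHS](row_sum_delta ('D_v g x)).
rewrite linear_sum fct_sumE; apply: eq_bigr => i _.
by rewrite linearZ /= -(deriveE _ (df _ (UU' _ Ux))).
Qed.

End SmoothOn.

Record chart (R : realType) (n : nat) (M : topologicalType) := Chart {
  chart_dom : set M;
  chart_map :> M -> 'rV[R]_n;
  chart_inv : 'rV[R]_n -> M;
  chart_open_dom : open chart_dom;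
  chart_open_image : open (chart_map @` chart_dom);
  chart_mapK : forall x, chart_dom x -> chart_inv (chart_map x) = x;
  chart_map_continuous :
    forall x, chart_dom x -> {for x, continuous chart_map};
  chart_inv_continuous :
    forall y, (chart_map @` chart_dom) y -> {for y, continuous chart_inv}
}.

Arguments chart_open_dom {R n M} c.
Arguments chart_open_image {R n M} c.

Definition smooth_in_charts (R : realType) (n m : nat) (M N : topologicalType)
    (phi : chart R n M) (psi : chart R m N) (h : M -> N) : Prop :=
  smooth_on (phi @` (chart_dom phi `&` h @^-1` chart_dom psi))
            (psi \o h \o chart_inv phi).

(* The smooth structure is the one generated by the (not necessarily maximal)
   atlas; smoothness below does not depend on the choice of generating atlas. *)
Record manifold (R : realType) (n : nat) := Manifold {
  manifold_carrier :> topologicalType;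
  atlas : set (chart R n manifold_carrier);
  manifold_hausdorff : hausdorff_space manifold_carrier;
  manifold_second_countable : @second_countable manifold_carrier;
  atlas_cover : forall x, exists2 phi, atlas phi & chart_dom phi x;
  atlas_compat : forall phi psi, atlas phi -> atlas psi ->
    smooth_in_charts phi psi id
}.

Section SmoothFunctions.
Variables (R : realType) (n : nat).
Implicit Types M N : manifold R n.

Definition smooth_function M (f : M -> R) : Prop :=
  forall phi, @atlas R n M phi ->
    smooth_on (phi @` chart_dom phi) (f \o chart_inv phi).

Definition smooth_map M N (h : M -> N) : Prop :=
  continuous h /\
  forall phi psi, @atlas R n M phi -> @atlas R n N psi ->
    smooth_in_charts phi psi h.

Lemma open_chart_image M (phi : chart R n M) (A : set M) :
  open A -> open (phi @` (chart_dom phi `&` A)).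
Proof.
move=> oA; rewrite openE => _ [x [Ux Ax] <-].
have imx : (phi @` chart_dom phi) (phi x) by exists x.
have nA : nbhs (phi x) (chart_inv phi @^-1` A).
  apply: (chart_inv_continuous imx); rewrite /= chart_mapK//.
  by apply: open_nbhs_nbhs.
have nU : nbhs (phi x) (phi @` chart_dom phi).
  by apply: open_nbhs_nbhs; split=> //; exact: chart_open_image.
apply: filterS2 nA nU => y Ay [z Uz zy].
by exists z => //; split=> //; move: Ay; rewrite /preimage /= -zy chart_mapK.
Qed.

Lemma smooth_function_comp M N (h : M -> N) (f : N -> R) :
  smooth_map h -> smooth_function f -> smooth_function (f \o h).
Proof.
move=> [ch sh] sf phi aphi k; apply: Ck_on_local => _ [x Ux <-].
have [psi apsi Vhx] := atlas_cover (h x).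
have oV : open (h @^-1` chart_dom psi).
  by apply: open_comp (chart_open_dom psi) => y _; exact: ch.
have oW := open_chart_image (phi := phi) oV.
exists (phi @` (chart_dom phi `&` h @^-1` chart_dom psi)).
  by exists x.
have kh := sh _ _ aphi apsi k; have kf := sf _ apsi k.
apply: (Ck_on_eq oW _ (Ck_on_comp oW _ kh kf)).
  by move=> _ [z [Uz Vz] <-] /=; rewrite chart_mapK// chart_mapK.
move=> _ [z [Uz Vz] <-] /=; rewrite chart_mapK//.
by exists (h z).
Qed.

Section Algebra.
Variable M : manifold R n.

Definition smooth_pred : {pred M -> R} :=
  mem [set f : M -> R | smooth_function f].

Record smoothfun := SmoothFun {
  smoothfun_val :> M -> R;
  smoothfun_mem : smoothfun_val \in smooth_pred
}.

HB.instance Definition _ := [isSub for smoothfun_val].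
HB.instance Definition _ := [Choice of smoothfun by <:].

Lemma smooth_predP (f : M -> R) : f \in smooth_pred <-> smooth_function f.
Proof. by rewrite inE. Qed.

Lemma smooth_subring_closed : subring_closed smooth_pred.
Proof.
have oI (phi : chart R n M) := chart_open_image phi.
split.
- by apply/smooth_predP => phi _ k; exact: Ck_on_cst.
- move=> f g /smooth_predP sf /smooth_predP sg; apply/smooth_predP.
  move=> phi aphi k.
  have -> : (f - g) \o chart_inv phi =
      (f \o chart_inv phi) + (-1) *: (g \o chart_inv phi).
    by apply/funext => x; rewrite !fctE /= scaleN1r.
  exact: Ck_onD (oI phi) (sf _ aphi k) (Ck_onZ _ (oI phi) (sg _ aphi k)).
- move=> f g /smooth_predP sf /smooth_predP sg; apply/smooth_predP.
  by move=> phi aphi k; exact: Ck_onM (oI phi) (sf _ aphi k) (sg _ aphi k).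
Qed.

HB.instance Definition _ :=
  GRing.isSubringClosed.Build (M -> R) smooth_pred smooth_subring_closed.
HB.instance Definition _ := 
  GRing.SubChoice_isSubComPzRing.Build _ _ smoothfun (subringClosedP _).

Lemma smooth_scaler_closed : GRing.scaler_closed smooth_pred.
Proof.
move=> c f /smooth_predP sf; apply/smooth_predP => phi aphi k.
pose g := f \o chart_inv phi.
exact: (Ck_onZ c (chart_open_image phi) (sf _ aphi k : Ck_on k _ g)).
Qed.

HB.instance Definition _ :=
  GRing.isScaleClosed.Build _ (M -> R) smooth_pred smooth_scaler_closed.
HB.instance Definition _ := [SubZmodule_isSubLmodule of smoothfun by <:].

End Algebra.
End SmoothFunctions.

Lemma smoothfun_smooth (R : realType) n (M : manifold R n) (f : smoothfun M) :
  smooth_function f.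
Proof. exact/smooth_predP/smoothfun_mem. Qed.

Definition mk_smoothfun (R : realType) n (M : manifold R n) (f : M -> R)
    (sf : smooth_function f) : smoothfun M :=
  SmoothFun ((smooth_predP f).2 sf).

Section TangentVectors.
Variables (R : realType) (n : nat).
Implicit Types M N : manifold R n.

Definition is_derivation M (p : M) (v : smoothfun M -> R) : Prop :=
  [/\ forall f g, v (f + g) = v f + v g,
      forall (c : R) f, v (c *: f) = c * v f &
      forall f g, v (f * g) = v f * g p + f p * v g].

Definition derivation_pred M (p : M) : {pred smoothfun M -> R} :=
  mem [set v | is_derivation p v].

(* T_p M, as the space of derivations at p of the algebra of smooth functions *)
Record tangent M (p : M) := Tangent {
  tangent_val :> smoothfun M -> R;
  tangent_mem : tangent_val \in derivation_pred p
}.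

HB.instance Definition _ M p := [isSub for @tangent_val M p].
HB.instance Definition _ M p := [Choice of @tangent M p by <:].

Lemma derivation_predP M (p : M) v :
  v \in derivation_pred p <-> is_derivation p v.
Proof. by rewrite inE. Qed.

Lemma derivation_submod_closed M (p : M) : submod_closed (derivation_pred p).
Proof.
split=> [|c u v /derivation_predP[uD uZ uM] /derivation_predP[vD vZ vM]].
  apply/derivation_predP; split=> [f g|c f|f g] /=.
  - by rewrite addr0.
  - by rewrite mulr0.
  - by rewrite mul0r mulr0 addr0.
have scaleE (x y : R) : x *: y = x * y :> R by [].
apply/derivation_predP; split=> [f g|d f|f g] /=.
- by rewrite !fctE uD vD scalerDr addrACA.
- by rewrite !fctE uZ vZ !scaleE; ring.
- by rewrite !fctE uM vM !scaleE; ring.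
Qed.

HB.instance Definition _ M (p : M) :=
  GRing.isSubmodClosed.Build R (smoothfun M -> R) (derivation_pred p)
    (GRing.submod_closed_semi (derivation_submod_closed p)).
HB.instance Definition _ M (p : M) :=
  [SubChoice_isSubLmodule of tangent p by <:].

Definition mk_tangent M (p : M) (v : smoothfun M -> R)
    (dv : is_derivation p v) : tangent p :=
  Tangent ((derivation_predP p v).2 dv).

Lemma tangentP M (p : M) (v : tangent p) : is_derivation p v.
Proof. exact/derivation_predP/tangent_mem. Qed.

End TangentVectors.

Section VectorFields.
Variables (R : realType) (n : nat) (M : manifold R n).

Record vfield := VField {
  vfield_val :> forall p : M, tangent p;
  vfield_smooth : forall f, smooth_function (fun p => vfield_val p f)
}.

Definition vfield_app (X : vfield) (f : smoothfun M) : smoothfun M :=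
  mk_smoothfun (vfield_smooth X f).

Lemma smoothfunP (f g : smoothfun M) : (forall p, f p = g p) -> f = g.
Proof. by move=> fg; apply/val_inj/funext. Qed.

Lemma tangent_eqP p (u v : @tangent R n M p) : (forall f, u f = v f) -> u = v.
Proof. by move=> uv; apply/val_inj/funext. Qed.

Lemma vfieldP (X Y : vfield) : (forall p f, X p f = Y p f) -> X = Y.
Proof.
case: X Y => [X sX] [Y sY] /= XY.
have E : X = Y.
  by apply: functional_extensionality_dep => p; exact: tangent_eqP.
by subst Y; congr VField; exact: Prop_irrelevance.
Qed.

Lemma vfield_zero_smooth f : smooth_function (fun p : M => (0 : tangent p) f).
Proof. exact: smoothfun_smooth (0 : smoothfun M). Qed.

Lemma vfield_opp_smooth (X : vfield) f :
  smooth_function (fun p : M => (- X p) f).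
Proof. exact: smoothfun_smooth (- vfield_app X f). Qed.

Lemma vfield_add_smooth (X Y : vfield) f :
  smooth_function (fun p : M => (X p + Y p) f).
Proof. exact: smoothfun_smooth (vfield_app X f + vfield_app Y f). Qed.

Lemma vfield_scale_smooth (a : smoothfun M) (X : vfield) f :
  smooth_function (fun p : M => (a p *: X p) f).
Proof. exact: smoothfun_smooth (a * vfield_app X f). Qed.

Definition vfield_zero := VField vfield_zero_smooth.
Definition vfield_opp X := VField (vfield_opp_smooth X).
Definition vfield_add X Y := VField (vfield_add_smooth X Y).
Definition vfield_scale a X := VField (vfield_scale_smooth a X).

HB.instance Definition _ := gen_eqMixin vfield.
HB.instance Definition _ := gen_choiceMixin vfield.

Lemma vfield_addA : associative vfield_add.
Proof. by move=> X Y Z; apply: vfieldP => p f /=; rewrite addrA. Qed.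
Lemma vfield_addC : commutative vfield_add.
Proof. by move=> X Y; apply: vfieldP => p f /=; rewrite addrC. Qed.
Lemma vfield_add0 : left_id vfield_zero vfield_add.
Proof. by move=> X; apply: vfieldP => p f /=; rewrite add0r. Qed.
Lemma vfield_addN : left_inverse vfield_zero vfield_opp vfield_add.
Proof. by move=> X; apply: vfieldP => p f /=; rewrite addNr. Qed.

HB.instance Definition _ := GRing.isZmodule.Build vfield
  vfield_addA vfield_addC vfield_add0 vfield_addN.

Lemma vfield_scaleA a b X :
  vfield_scale a (vfield_scale b X) = vfield_scale (a * b) X.
Proof. by apply: vfieldP => p f /=; rewrite scalerA. Qed.
Lemma vfield_scale1 : left_id 1 vfield_scale.
Proof. by move=> X; apply: vfieldP => p f /=; rewrite scale1r. Qed.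
Lemma vfield_scaleDr : right_distributive vfield_scale +%R.
Proof. by move=> a X Y; apply: vfieldP => p f /=; rewrite scalerDr. Qed.
Lemma vfield_scaleDl X : {morph vfield_scale^~ X : a b / a + b}.
Proof. by move=> a b; apply: vfieldP => p f /=; rewrite scalerDl. Qed.

HB.instance Definition _ := GRing.Zmodule_isLmodule.Build (smoothfun M) vfield
  vfield_scaleA vfield_scale1 vfield_scaleDr vfield_scaleDl.

Lemma vfield_appD X (f g : smoothfun M) :
  vfield_app X (f + g) = vfield_app X f + vfield_app X g.
Proof. by apply: smoothfunP => p /=; have [-> _ _] := tangentP (X p). Qed.

Lemma vfield_appZ X (c : R) (f : smoothfun M) :
  vfield_app X (c *: f) = c *: vfield_app X f.
Proof. by apply: smoothfunP => p /=; have [_ -> _] := tangentP (X p). Qed.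

Lemma vfield_appM X (f g : smoothfun M) :
  vfield_app X (f * g) = vfield_app X f * g + f * vfield_app X g.
Proof. by apply: smoothfunP => p /=; have [_ _ ->] := tangentP (X p). Qed.

Lemma bracket_is_derivation (X Y : vfield) (p : M) :
  is_derivation p
    (fun f => X p (vfield_app Y f) - Y p (vfield_app X f)).
Proof.
have [XD XZ XM] := tangentP (X p); have [YD YZ YM] := tangentP (Y p).
split=> [f g|c f|f g].
- by rewrite !vfield_appD XD YD opprD addrACA.
- by rewrite !vfield_appZ XZ YZ mulrBr.
- by rewrite !vfield_appM XD YD !XM !YM /=; ring.
Qed.

Lemma bracket_smooth (X Y : vfield) f :
  smooth_function (fun p => mk_tangent (bracket_is_derivation X Y p) f).
Proof.
exact: smoothfun_smooth
  (vfield_app X (vfield_app Y f) - vfield_app Y (vfield_app X f)).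
Qed.

Definition bracket (X Y : vfield) : vfield := VField (bracket_smooth X Y).

End VectorFields.

Section Connections.
Variables (R : realType) (n : nat) (M : manifold R n).

(* D a b is the covariant derivative of b along a *)
Record connection := Connection {
  nabla :> vfield M -> vfield M -> vfield M;
  nablaDl : forall a b c, nabla (a + b) c = nabla a c + nabla b c;
  nablaZl : forall (f : smoothfun M) a c, nabla (f *: a) c = f *: nabla a c;
  nablaDr : forall a b c, nabla a (b + c) = nabla a b + nabla a c;
  nabla_leibniz : forall a (f : smoothfun M) b,
    nabla a (f *: b) = vfield_app a f *: b + f *: nabla a b
}.

Definition torsion (D : connection) (a b : vfield M) : vfield M :=
  D a b - D b a - bracket a b.

Definition curvature (D : connection) (a b c : vfield M) : vfield M :=
  D a (D b c) - D b (D a c) - D (bracket a b) c.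

Record metric := Metric {
  metric_val :> forall p : M, tangent p -> tangent p -> R;
  metricDl : forall p (u v w : tangent p),
    metric_val (u + v) w = metric_val u w + metric_val v w;
  metricZl : forall p (c : R) (u w : tangent p),
    metric_val (c *: u) w = c * metric_val u w;
  metricC : forall p (u v : tangent p), metric_val u v = metric_val v u;
  metric_nondegenerate : forall p (u : tangent p),
    (forall v : tangent p, metric_val u v = 0) -> u = 0;
  metric_smooth : forall X Y : vfield M,
    smooth_function (fun p => metric_val (X p) (Y p))
}.

Definition metric_app (g : metric) (X Y : vfield M) : smoothfun M :=
  mk_smoothfun (metric_smooth g X Y).

(* the covariant derivative of the metric tensor: (D_a g)(b, c) *)
Definition cov_metric (D : connection) (g : metric) (a b c : vfield M) :
    smoothfun M :=
  vfield_app a (metric_app g b c)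
  - metric_app g (D a b) c - metric_app g b (D a c).

Definition compatible (D : connection) (g : metric) : Prop :=
  forall a b c, cov_metric D g a b c = 0.

End Connections.

Section Diffeomorphisms.
Variables (R : realType) (n : nat).
Implicit Types M N : manifold R n.

Record diffeo M N := Diffeo {
  diffeo_map :> M -> N;
  diffeo_inv_map : N -> M;
  diffeoK : cancel diffeo_map diffeo_inv_map;
  diffeoKV : cancel diffeo_inv_map diffeo_map;
  diffeo_smooth : smooth_map diffeo_map;
  diffeo_inv_smooth : smooth_map diffeo_inv_map
}.

Definition diffeo_inv M N (h : diffeo M N) : diffeo N M :=
  Diffeo (diffeoKV h) (diffeoK h) (diffeo_inv_smooth h) (diffeo_smooth h).

Definition pullback_fun M N (h : diffeo M N) (f : smoothfun N) : smoothfun M :=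
  mk_smoothfun (smooth_function_comp (diffeo_smooth h) (smoothfun_smooth f)).

Lemma differential_is_derivation M N (h : diffeo M N) (p : M) (v : tangent p) :
  is_derivation (h p) (fun f => v (pullback_fun h f)).
Proof.
have [vD vZ vM] := tangentP v; split=> [f g|c f|f g].
- by rewrite -vD; congr (v _); exact: smoothfunP.
- by rewrite -vZ; congr (v _); exact: smoothfunP.
- rewrite -[g (h p)]/(pullback_fun h g p) -[f (h p)]/(pullback_fun h f p) -vM.
  by congr (v _); exact: smoothfunP.
Qed.

Definition differential M N (h : diffeo M N) (p : M) (v : tangent p) :
    tangent (h p) :=
  mk_tangent (differential_is_derivation h v).

Lemma pushforward_is_derivation M N (h : diffeo M N) (X : vfield M) (q : N) :
  is_derivation q (fun f => X (diffeo_inv h q) (pullback_fun h f)).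
Proof.
rewrite -{1}[q](diffeoKV h).
exact: differential_is_derivation (X (diffeo_inv h q)).
Qed.

Lemma pushforward_smooth M N (h : diffeo M N) (X : vfield M) f :
  smooth_function (fun q => mk_tangent (pushforward_is_derivation h X q) f).
Proof.
exact: smoothfun_smooth
  (pullback_fun (diffeo_inv h) (vfield_app X (pullback_fun h f))).
Qed.

(* (h_* X)_q = dh (X_p) with p = h^-1 q; spelled out on functions since
   dh (X_p) has type T_(h p) N, not T_q N *)
Definition pushforward M N (h : diffeo M N) (X : vfield M) : vfield N :=
  VField (pushforward_smooth h X).

Lemma pushforwardE M N (h : diffeo M N) (X : vfield M) (p : M) :
  pushforward h X (h p) = differential h (X p).
Proof. by apply: tangent_eqP => f /=; rewrite diffeoK. Qed.

Lemma pushforwardK M N (h : diffeo M N) :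
  cancel (pushforward h) (pushforward (diffeo_inv h)).
Proof.
move=> X; apply: vfieldP => p f /=; rewrite diffeoK.
by congr (X p _); apply: smoothfunP => q /=; rewrite diffeoK.
Qed.

Section PullbackMetric.
Variables (M N : manifold R n) (h : diffeo M N) (eta : metric N).

Let g (p : M) (u v : tangent p) : R :=
  eta (h p) (differential h u) (differential h v).

Lemma differentialD (p : M) (u v : tangent p) :
  differential h (u + v) = differential h u + differential h v.
Proof. exact: tangent_eqP. Qed.

Lemma differentialZ (p : M) (c : R) (u : tangent p) :
  differential h (c *: u) = c *: differential h u.
Proof. exact: tangent_eqP. Qed.

Lemma differential_inj (p : M) (u : tangent p) :
  differential h u = 0 -> u = 0.
Proof.
move=> du0; apply: tangent_eqP => f.
transitivity (differential h u (pullback_fun (diffeo_inv h) f)).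
  by rewrite /=; congr (u _); apply: smoothfunP => q /=; rewrite diffeoK.
by rewrite du0.
Qed.

Lemma differential_surj (p : M) (w : tangent (h p)) :
  exists u : tangent p, w = differential h u.
Proof.
have dw : is_derivation p (fun f => w (pullback_fun (diffeo_inv h) f)).
  have [wD wZ wM] := tangentP w; split=> [f f'|c f|f f'].
  - by rewrite -wD; congr (w _); exact: smoothfunP.
  - by rewrite -wZ; congr (w _); exact: smoothfunP.
  - have E k : smoothfun_val k p = pullback_fun (diffeo_inv h) k (h p).
      by rewrite /= diffeoK.
    rewrite (E f) (E f') -wM.
    by congr (w _); exact: smoothfunP.
exists (mk_tangent dw); apply: tangent_eqP => f /=.
by congr (w _); apply: smoothfunP => q /=; rewrite diffeoKV.
Qed.

Lemma pullback_metricDl p (u v w : tangent p) : g (u + v) w = g u w + g v w.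
Proof. by rewrite /g differentialD metricDl. Qed.

Lemma pullback_metricZl p (c : R) (u w : tangent p) : g (c *: u) w = c * g u w.
Proof. by rewrite /g differentialZ metricZl. Qed.

Lemma pullback_metricC p (u v : tangent p) : g u v = g v u.
Proof. by rewrite /g metricC. Qed.

Lemma pullback_metric_nondegenerate p (u : tangent p) :
  (forall v : tangent p, g u v = 0) -> u = 0.
Proof.
move=> gu0; apply: differential_inj; apply: (@metric_nondegenerate _ _ _ eta).
by move=> w; have [v ->] := differential_surj w; exact: gu0.
Qed.

Lemma pullback_metric_smooth (X Y : vfield M) :
  smooth_function (fun p => g (X p) (Y p)).
Proof.
rewrite (_ : (fun p => _) = pullback_fun h
  (metric_app eta (pushforward h X) (pushforward h Y))).
  exact: smoothfun_smooth.
by apply/funext => p; rewrite /g -!pushforwardE.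
Qed.

(* (h^* eta)_p(u, v) = eta_(h p)(dh u, dh v) *)
Definition pullback_metric : metric M :=
  Metric pullback_metricDl pullback_metricZl pullback_metricC
    pullback_metric_nondegenerate pullback_metric_smooth.

End PullbackMetric.

Definition is_pullback_connection M N (h : diffeo M N) (D : connection N)
    (D' : connection M) : Prop :=
  forall u v : vfield N,
    pushforward (diffeo_inv h) (D v u) =
    D' (pushforward (diffeo_inv h) v) (pushforward (diffeo_inv h) u).

Section PullbackConnection.
Variables (M N : manifold R n) (h : diffeo M N).

Lemma pushforwardKV :
  cancel (pushforward (diffeo_inv h)) (pushforward h).
Proof.
move=> X; apply: vfieldP => p f /=; rewrite diffeoKV.
by congr (X p _); apply: smoothfunP => q /=; rewrite diffeoKV.
Qed.

Lemma pushforwardD (X Y : vfield M) :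
  pushforward h (X + Y) = pushforward h X + pushforward h Y.
Proof. exact: vfieldP. Qed.

Lemma pushforwardZ (f : smoothfun M) (X : vfield M) :
  pushforward h (f *: X) = pullback_fun (diffeo_inv h) f *: pushforward h X.
Proof. exact: vfieldP. Qed.

Lemma vfield_app_pushforward (X : vfield M) (f : smoothfun N) :
  vfield_app (pushforward h X) f =
  pullback_fun (diffeo_inv h) (vfield_app X (pullback_fun h f)).
Proof. exact: smoothfunP. Qed.

End PullbackConnection.

(* the equation does determine a connection *)
Lemma pullback_connection_exists M N (h : diffeo M N) (D : connection N) :
  exists! D' : connection M, is_pullback_connection h D D'.
Proof.
pose nab (a b : vfield M) : vfield M :=
  pushforward (diffeo_inv h) (D (pushforward h a) (pushforward h b)).
have pullK (f : smoothfun M) :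
    pullback_fun h (pullback_fun (diffeo_inv h) f) = f.
  by apply: smoothfunP => p /=; rewrite diffeoK.
have D1 a b c : nab (a + b) c = nab a c + nab b c.
  by rewrite /nab pushforwardD nablaDl pushforwardD.
have D2 (f : smoothfun M) a c : nab (f *: a) c = f *: nab a c.
  rewrite /nab pushforwardZ nablaZl pushforwardZ; congr (_ *: _).
  exact: pullK.
have D3 a b c : nab a (b + c) = nab a b + nab a c.
  by rewrite /nab pushforwardD nablaDr pushforwardD.
have D4 a (f : smoothfun M) b :
    nab a (f *: b) = vfield_app a f *: b + f *: nab a b.
  rewrite /nab pushforwardZ nabla_leibniz pushforwardD !pushforwardZ.
  rewrite pushforwardK vfield_app_pushforward pullK.
  by congr (_ *: _ + _ *: _); exact: pullK.
exists (Connection D1 D2 D3 D4); split.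
  by move=> u v; rewrite /= /nab !pushforwardKV.
case=> nab' E1 E2 E3 E4 nab'P; have E : nab = nab'.
  apply/funext => a; apply/funext => b; rewrite /nab nab'P /=.
  by rewrite !pushforwardK.
by subst nab'; congr Connection; exact: Prop_irrelevance.
Qed.

End Diffeomorphisms.

(* Main.v *)
(** Pushforward along a diffeomorphism is a linear bijection of vector fields
    that commutes with the Lie bracket, so it carries the torsion and the
    curvature of a connection to those of its pullback. *)
Require Import Defs.
From mathcomp Require Import all_boot all_order all_algebra.
From mathcomp Require Import boolp classical_sets functions reals.
From mathcomp Require Import topology normedtype.
Import GRing.Theory.
Local Open Scope ring_scope.

Section PushforwardNaturality.
Variables (R : realType) (n : nat) (M N : manifold R n) (h : diffeo M N).

Lemma pushforwardB (X Y : vfield M) :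
  pushforward h (X - Y) = pushforward h X - pushforward h Y.
Proof. exact: vfieldP. Qed.

Lemma pushforward0 : pushforward h 0 = 0.
Proof. exact: vfieldP. Qed.

(** This says that [X] and its pushforward are [h]-related, the form in which nested derivations can
    be moved across [h]. *)
Lemma pullback_fun_vfield_app (X : vfield M) (f : smoothfun N) :
  pullback_fun h (vfield_app (pushforward h X) f) =
  vfield_app X (pullback_fun h f).
Proof. by apply: smoothfunP => p /=; rewrite diffeoK. Qed.

(** On a function [f], each term on the right derives along one pushed field and then the other;
    [h]-relatedness turns the inner derivative into one on [M]. *)
Lemma pushforward_bracket (X Y : vfield M) :
  pushforward h (bracket X Y) = bracket (pushforward h X) (pushforward h Y).
Proof.
by apply: vfieldP => q f; rewrite /= !pullback_fun_vfield_app.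
Qed.

End PushforwardNaturality.

Section PullbackConnectionNaturality.
Variables (R : realType) (n : nat) (M N : manifold R n) (h : diffeo M N).
Variables (D : connection N) (D' : connection M).
Hypothesis pullD : is_pullback_connection h D D'.

Let push := pushforward (diffeo_inv h).

Lemma pullback_torsion (a b : vfield N) :
  torsion D' (push a) (push b) = push (torsion D a b).
Proof. by rewrite /torsion /push !pushforwardB pushforward_bracket !pullD. Qed.

Lemma pullback_curvature (a b c : vfield N) :
  curvature D' (push a) (push b) (push c) = push (curvature D a b c).
Proof.
(* The bracket is folded back into a pushed field, since [pullD] turns the last term on the right
   into [D'] along [push (bracket a b)]. *)
by rewrite /curvature /push !pushforwardB -pushforward_bracket !pullD.
Qed.

End PullbackConnectionNaturality.

Arguments pullback_torsion {R n M N h D D'} pullD a b.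
Arguments pullback_curvature {R n M N h D D'} pullD a b c.

Theorem mainTheorem3 (R : realType) (n : nat) (M : manifold R n)
    (eta : metric M) (etaD : connection M) (eta_compat : compatible etaD eta)
    (h : diffeo M M)
    (g : metric M) (g_def : g = pullback_metric h eta)
    (gD : connection M) (gD_def : is_pullback_connection h etaD gD)
    (flat : forall a b c : vfield M, curvature etaD a b c = 0)
    (torsion_free : forall a b : vfield M, torsion etaD a b = 0) :
  (forall a b c : vfield M, curvature gD a b c = 0) /\
  (forall a b : vfield M, torsion gD a b = 0).
Proof.
split=> [a b c|a b].
  (* Naturality only concerns fields of the form [push _]; every field on [M] is one, namely the
     image of its own pushforward by [h]. *)
  rewrite -[a](pushforwardK h) -[b](pushforwardK h) -[c](pushforwardK h).
  by rewrite (pullback_curvature gD_def) flat pushforward0.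
rewrite -[a](pushforwardK h) -[b](pushforwardK h).
by rewrite (pullback_torsion gD_def) torsion_free pushforward0.
Qed.
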